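(* Let $d\ge4$ be an even integer and let $V\in U(d)$ be a skew-symmetric unitary matrix ($V^\top=-V$). For $k=1,\dots,\frac d2-1$ consider the linear map $$\mathcal{L}_k^{\mathrm{BH}}:M_d(\mathbb{C})\to M_d(\mathbb{C}),\qquad Z\mapsto\frac{1}{kd-k-1}\big(k\operatorname{Tr}(Z)I_d-Z-kVZ^\top V^*\big).$$ Then for every $k=1,\dots,\frac d2-1$: (1) $\mathcal{L}_k^{\mathrm{BH}}$ is an optimal $k$-positive indecomposable linear map; that is, $\mathcal{L}_k^{\mathrm{BH}}$ is $k$-positive, not $(k+1)$-positive, and indecomposable, and whenever $\mathcal{L}':M_d(\mathbb{C})\to M_d(\mathbb{C})$ is a $k$-positive indecomposable linear map with $$\{\rho \text{ PPT}:\operatorname{Tr}(\rho\, C_{\mathcal{L}_k^{\mathrm{BH}}})<0\}\subseteq\{\rho\text{ PPT}:\operatorname{Tr}(\rho\, C_{\mathcal{L}'})<0\},$$ one has $\mathcal{L}'=c\,\mathcal{L}_k^{\mathrm{BH}}$ for some $c>0$. (2) $\mathcal{L}_k^{\mathrm{BH}}$ cannot be written as $\mathcal{L}'+\top\circ\mathcal{L}''$ for any $(k+1)$-positive linear maps $\mathcal{L}',\mathcal{L}'':M_d(\mathbb{C})\to M_d(\mathbb{C})$.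
   Context: A linear map $\mathcal{L}:M_d(\mathbb{C})\to M_d(\mathbb{C})$ is $k$-positive if $\mathrm{id}_k\otimes\mathcal{L}$ on $M_k(\mathbb{C})\otimes M_d(\mathbb{C})$ maps positive semidefinite matrices to positive semidefinite matrices; completely positive (CP) if $k$-positive for all $k$; completely copositive (co-CP) if $\top\circ\mathcal{L}$ is CP, where $\top(Z)=Z^\top$; decomposable if it is the sum of a CP and a co-CP map, and indecomposable otherwise. The normalized Choi matrix is $C_{\mathcal{L}}=\frac1d\sum_{i,j=1}^d|i\rangle\langle j|\otimes\mathcal{L}(|i\rangle\langle j|)$. ''$\rho$ PPT'' means that $\rho$ is a quantum state on $\mathbb{C}^d\otimes\mathbb{C}^d$ (positive semidefinite, trace one) whose partial transpose $(\mathrm{id}\otimes\top)(\rho)$ is positive semidefinite. *)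

(* Defs.v *)
From HB Require Import structures.
From mathcomp Require Import all_boot all_order all_algebra.
From mathcomp Require Import mxtens sesquilinear spectral ring.

Set Implicit Arguments.
Unset Strict Implicit.
Unset Printing Implicit Defensive.

Import GRing.Theory Num.Theory.
Local Open Scope ring_scope.
Local Open Scope sesquilinear_scope.

Section Maps.
Variable C : numClosedFieldType.

(* In C, [0 <= z] means that z is real and nonnegative, so a matrix with this
   property is automatically Hermitian. *)
Definition psdmx n (A : 'M[C]_n) : Prop :=
  forall x : 'cV[C]_n, 0 <= (x ^t* *m A *m x) 0 0.

(* The tensor product of linear maps, by expansion in the basis of the
   E_ij (x) E_ab; see [tens_map_tens]. *)
Definition tens_map m n p q (f : 'M[C]_m -> 'M[C]_p) (g : 'M[C]_n -> 'M[C]_q)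
    (X : 'M[C]_(m * n)) : 'M[C]_(p * q) :=
  \sum_(i < m) \sum_(j < m) \sum_(a < n) \sum_(b < n)
    X (mxtens_index (i, a)) (mxtens_index (j, b)) *:
      (f (delta_mx i j) *t g (delta_mx a b)).

Lemma tens_map_tens m n p q (f : {linear 'M[C]_m -> 'M[C]_p})
    (g : {linear 'M[C]_n -> 'M[C]_q}) (A : 'M[C]_m) (B : 'M[C]_n) :
  tens_map f g (A *t B) = f A *t g B.
Proof.
rewrite [in RHS](matrix_sum_delta A) [in RHS](matrix_sum_delta B).
rewrite !linear_sum /=; apply/matrixP => k l; case: (mxtens_indexP k) => i a.
case: (mxtens_indexP l) => j b; rewrite tensmxE !summxE mulr_suml.
apply: eq_bigr => i' _; rewrite linear_sum !summxE mulr_suml.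
apply: eq_bigr => j' _; rewrite summxE mulr_sumr.
apply: eq_bigr => a' _; rewrite linear_sum !summxE mulr_sumr.
apply: eq_bigr => b' _.
by rewrite !linearZ !mxE !mxtens_indexK /= mulrACA.
Qed.

Section FixedDim.
Variable d : nat.
Implicit Types L : 'M[C]_d -> 'M[C]_d.

Definition k_positive (k : nat) L : Prop :=
  forall X : 'M[C]_(k * d), psdmx X -> psdmx (tens_map (@idfun 'M[C]_k) L X).

Definition completely_positive L : Prop := forall k, k_positive k L.

Definition completely_copositive L : Prop := completely_positive (trmx \o L).

Definition decomposable L : Prop :=
  exists L1 L2 : {linear 'M[C]_d -> 'M[C]_d},
    [/\ completely_positive L1, completely_copositive L2 &
        forall Z, L Z = L1 Z + L2 Z].

Definition choi L : 'M[C]_(d * d) :=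
  d%:R^-1 *: \sum_(i < d) \sum_(j < d) delta_mx i j *t L (delta_mx i j).

Definition state n (rho : 'M[C]_n) : Prop := psdmx rho /\ \tr rho = 1.

Definition ppt (rho : 'M[C]_(d * d)) : Prop :=
  state rho /\ psdmx (tens_map (@idfun 'M[C]_d) (@trmx C d d) rho).

Definition detects L (rho : 'M[C]_(d * d)) : Prop :=
  ppt rho /\ \tr (rho *m choi L) < 0.

Definition optimal_k_positive_indecomposable (k : nat)
    (L : {linear 'M[C]_d -> 'M[C]_d}) : Prop :=
  [/\ k_positive k L, ~ k_positive k.+1 L, ~ decomposable L &
      forall L' : {linear 'M[C]_d -> 'M[C]_d},
        k_positive k L' -> ~ decomposable L' ->
        (forall rho, detects L rho -> detects L' rho) ->
        exists2 c : C, 0 < c & forall Z, L' Z = c *: L Z].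

Definition BHmap (k : nat) (V Z : 'M[C]_d) : 'M[C]_d :=
  (k%:R * d%:R - k%:R - 1)^-1 *:
    ((k%:R * \tr Z)%:M - Z - k%:R *: (V *m Z^T *m V ^t*)).

Fact BHmap_is_linear k V : linear (BHmap k V).
Proof.
move=> a Y Z; rewrite /BHmap; move: (_^-1) => c.
have -> : V *m (a *: Y + Z)^T *m V ^t* =
    a *: (V *m Y^T *m V ^t*) + V *m Z^T *m V ^t*.
  by rewrite [(_ + _)^T]linearP /= mulmxDr mulmxDl -scalemxAr -scalemxAl.
rewrite mxtraceD mxtraceZ; move: (V *m Y^T *m _) (V *m Z^T *m _) => P Q.
move: (\tr Y) (\tr Z) k%:R => t u s.
apply/matrixP => i j; rewrite !mxE.
by case: (i == j); rewrite ?mulr1n ?mulr0n; ring.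
Qed.

HB.instance Definition _ k V :=
  GRing.isLinear.Build C 'M[C]_d 'M[C]_d _ (BHmap k V) (BHmap_is_linear k V).

End FixedDim.
End Maps.

(* Main.v *)
Require Import Defs.
From HB Require Import structures.
From mathcomp Require Import all_boot all_order all_algebra.
From mathcomp Require Import boolp mxtens sesquilinear complex spectral reals ring.

Set Implicit Arguments.
Unset Strict Implicit.
Unset Printing Implicit Defensive.

Import Order.TTheory GRing.Theory Num.Theory Num.Def.
Local Open Scope ring_scope.
Local Open Scope sesquilinear_scope.

(* Write [M^H] for the adjoint of [M] and [vec A] for the vector of
   [C^d (x) C^d] with coefficient matrix [A]. A map [L] is
   k-positive iff [Q_L A := vec(A)^H choi(L) vec(A)] is nonnegative on matrices
   of rank at most [k]. With [T := V A - (V A)^T], the form of the Breuer-Hall map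
   is a positive multiple of [k/2 |T|^2 - 1/4 |tr (V^H T)|^2]. Since [T] has rank
   at most [2k], Cauchy-Schwarz gives k-positivity. If the columns of the [d x m]
   matrix [Z] are orthonormal and isotropic for the alternating form [V]
   (possible when [2m <= d]), then [Q (Z Z^H)] is a positive multiple of
   [m (k - m)]: negative for [m = k + 1], zero for [m = k].

   Part (2): [Q_L] vanishes at every [z (V z)^T]. If [L = L' + T o L''], then the
   form of [L''] vanishes at every product [z (V z)^H]; as [L''] is 2-positive,
   the Choi matrix of [L''] kills these vectors, and they span. So [L'' = 0] and
   [L = L'] would be (k+1)-positive. Indecomposability is a special case.

   Optimality: let [S] be a sum of projections onto spanning vectors
   [vec (Z Z^H)], with [m = k], and [R] one onto vectors [vec (z (V z)^T)] whose
   partial transposes span. Both pair to zero with the Choi matrix of the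
   Breuer-Hall map [L] and nonnegatively with that of any k-positive [L']. For
   Hermitian [X], the matrix [X + K1 S + K2 R] is PPT for suitable
   [K1, K2 >= 0], so if [L] is negative at [X], then so is any [L'] that detects
   at least as much. Two real functionals in this relation are proportional. *)

(** * Positive semidefinite matrices *)

Section Matrices.
Variable C : numClosedFieldType.

Lemma mxBE m n (A B : 'M[C]_(m, n)) i j : (A - B) i j = A i j - B i j.
Proof. by rewrite !mxE. Qed.

Lemma mxZE m n a (A : 'M[C]_(m, n)) i j : (a *: A) i j = a * A i j.
Proof. by rewrite mxE. Qed.

Lemma adjmx_mul m n p (A : 'M[C]_(m, n)) (B : 'M[C]_(n, p)) :
  (A *m B) ^t* = B ^t* *m A ^t*.
Proof. by rewrite trmx_mul map_mxM. Qed.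

Lemma adjmxD m n (A B : 'M[C]_(m, n)) : (A + B) ^t* = A ^t* + B ^t*.
Proof. by rewrite linearD map_mxD. Qed.

Lemma adjmxN m n (A : 'M[C]_(m, n)) : (- A) ^t* = - A ^t*.
Proof. by rewrite linearN map_mxN. Qed.

Lemma adjmxZ m n a (A : 'M[C]_(m, n)) : (a *: A) ^t* = a^* *: A ^t*.
Proof. by rewrite linearZ map_mxZ. Qed.

Lemma adjmx1 n : (1%:M : 'M[C]_n) ^t* = 1%:M.
Proof. by rewrite trmx1 map_mx1. Qed.

Lemma mxtrace_adj n (A : 'M[C]_n) : \tr (A ^t*) = (\tr A)^*.
Proof. by rewrite trace_map_mx mxtrace_tr. Qed.

Lemma mxtrace_gram m n (A : 'M[C]_(m, n)) :
  \tr (A ^t* *m A) = \sum_i \sum_j `|A j i| ^+ 2.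
Proof.
apply: eq_bigr => i _; rewrite mxE; apply: eq_bigr => j _.
by rewrite !mxE normCKC.
Qed.

Lemma mxtrace_gram_ge0 m n (A : 'M[C]_(m, n)) : 0 <= \tr (A ^t* *m A).
Proof.
by rewrite mxtrace_gram; do 2!apply: sumr_ge0 => ? _; rewrite exprn_ge0.
Qed.

Lemma mxtrace_gram_eq0 m n (A : 'M[C]_(m, n)) : \tr (A ^t* *m A) = 0 -> A = 0.
Proof.
rewrite mxtrace_gram => /eqP; rewrite psumr_eq0; last first.
  by move=> i _; apply: sumr_ge0 => j _; rewrite exprn_ge0.
move=> /allP A0; apply/matrixP => j i; rewrite mxE.
have := A0 i (mem_index_enum _); rewrite psumr_eq0; last first.
  by move=> *; rewrite exprn_ge0.
by move=> /allP/(_ j (mem_index_enum _)); rewrite sqrf_eq0 normr_eq0 => /eqP.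
Qed.

(** The squared norm of [a Y - b X] is [a (a c - |b|^2)], so for [a > 0] the second factor is
    nonnegative. *)
Lemma mxtrace_cauchy_schwarz m n (X Y : 'M[C]_(m, n)) :
  `|\tr (X ^t* *m Y)| ^+ 2 <= \tr (X ^t* *m X) * \tr (Y ^t* *m Y).
Proof.
set a := \tr (X ^t* *m X); set b := \tr (X ^t* *m Y); set c := \tr (Y ^t* *m Y).
have [a0|aN0] := eqVneq a 0.
  by rewrite /b (mxtrace_gram_eq0 a0) trmx0 map_mx0 mul0mx mxtrace0 normr0 expr0n
     a0 mul0r.
have a_gt0 : 0 < a by rewrite lt_def aN0 mxtrace_gram_ge0.
have ca : a^* = a by apply/CrealP/ger0_real/ltW.
have cb : \tr (Y ^t* *m X) = b^* by rewrite -mxtrace_adj adjmx_mul trmxCK.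
have := mxtrace_gram_ge0 (a *: Y - b *: X).
rewrite adjmxD adjmxN !adjmxZ mulmxDl !mulmxDr !mulNmx !mulmxN opprK.
rewrite -!scalemxAl -!scalemxAr !(mxtraceD, mxtraceZ, raddfN) /= !mxtraceZ.
rewrite ca -/a -/b -/c cb normCK.
have -> : a * (a * c) - a * (b * b^*) + (- (b^* * (a * b)) + b^* * (b * a)) =
          a * (a * c - b * b^*) by ring.
by rewrite pmulr_rge0 // subr_ge0.
Qed.

Lemma sesqui_mxtrace m n (u : 'cV[C]_m) (M : 'M[C]_(m, n)) (v : 'cV[C]_n) :
  (u ^t* *m M *m v) 0 0 = \tr (M *m (v *m u ^t*)).
Proof. by rewrite -trace_mx11 -mulmxA [LHS]mxtrace_mulC mulmxA. Qed.

(** The zeros at [u + v] and [u + 'i v] force the sum and the difference of the two cross terms to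
    vanish. *)
Lemma quadratic_polarization n (M : 'M[C]_n) :
  (forall z : 'cV[C]_n, (z ^t* *m M *m z) 0 0 = 0) -> M = 0.
Proof.
move=> M0.
have B0 (u v : 'cV[C]_n) : (u ^t* *m M *m v) 0 0 = 0.
  have expand c : c * (u ^t* *m M *m v) 0 0 + c^* * (v ^t* *m M *m u) 0 0 = 0.
    have := M0 (u + c *: v).
    rewrite adjmxD adjmxZ !mulmxDl !mulmxDr -!scalemxAl -!scalemxAr.
    do !rewrite [fun_of_matrix (_ + _) _ _]mxE.
    do !rewrite [fun_of_matrix (_ *: _) _ _]mxE.
    by rewrite !M0 !mulr0 addr0 add0r.
  have := expand 1; have := expand 'i; rewrite rmorph1 conjCi !mul1r.
  rewrite mulNr -mulrBr => /eqP; rewrite mulf_eq0 (negPf (neq0Ci C)) subr_eq0.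
  by move=> /eqP <- /eqP; rewrite -mulr2n mulrn_eq0 => /eqP.
apply/matrixP => i j; rewrite mxE -[RHS](B0 (delta_mx i 0) (delta_mx j 0)).
rewrite -colE !mxE (bigD1 i) //= big1 ?addr0 => [|l /negPf il]; last first.
  by rewrite !mxE il /= rmorph0 mul0r.
by rewrite !mxE !eqxx rmorph1 mul1r.
Qed.

Lemma quadratic_form_inj n (M N : 'M[C]_n) :
  (forall z : 'cV[C]_n, (z ^t* *m M *m z) 0 0 = (z ^t* *m N *m z) 0 0) -> M = N.
Proof.
move=> MN; apply/eqP; rewrite -subr_eq0; apply/eqP/quadratic_polarization => z.
rewrite mulmxBr mulmxBl [fun_of_matrix (_ + _) _ _]mxE.
by rewrite [fun_of_matrix (- _) _ _]mxE MN subrr.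
Qed.

Lemma conj_sesqui m n (u : 'cV[C]_m) (M : 'M[C]_(m, n)) (v : 'cV[C]_n) :
  ((u ^t* *m M *m v) 0 0)^* = (v ^t* *m M ^t* *m u) 0 0.
Proof.
by rewrite -!trace_mx11 -mxtrace_adj !adjmx_mul trmxCK mulmxA.
Qed.

Lemma real_form_hermitian n (M : 'M[C]_n) :
  (forall z : 'cV[C]_n, (z ^t* *m M *m z) 0 0 \is Num.real) -> M ^t* = M.
Proof.
by move=> Mr; apply: quadratic_form_inj => z; rewrite -conj_sesqui; apply/CrealP.
Qed.

Lemma hermitian_form_real n (M : 'M[C]_n) (z : 'cV[C]_n) :
  M ^t* = M -> (z ^t* *m M *m z) 0 0 \is Num.real.
Proof. by move=> hM; apply/CrealP; rewrite conj_sesqui hM. Qed.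

Lemma psdmx_hermitian n (M : 'M[C]_n) : psdmx M -> M ^t* = M.
Proof. by move=> pM; apply: real_form_hermitian => z; apply/ger0_real/pM. Qed.

Lemma psdmxD n (A B : 'M[C]_n) : psdmx A -> psdmx B -> psdmx (A + B).
Proof.
by move=> pA pB z; rewrite mulmxDr mulmxDl [fun_of_matrix _ _ _]mxE addr_ge0.
Qed.

Lemma psdmxZ n a (A : 'M[C]_n) : 0 <= a -> psdmx A -> psdmx (a *: A).
Proof.
move=> a0 pA z.
by rewrite -scalemxAr -scalemxAl [fun_of_matrix _ _ _]mxE mulr_ge0.
Qed.

Lemma psdmx_gram m n (G : 'M[C]_(m, n)) : psdmx (G ^t* *m G).
Proof.
move=> z; have := mxtrace_gram_ge0 (G *m z).
by rewrite adjmx_mul trace_mx11 !mulmxA.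
Qed.

Lemma psdmx_congr m n (G : 'M[C]_(m, n)) (A : 'M[C]_m) :
  psdmx A -> psdmx (G ^t* *m A *m G).
Proof. by move=> pA z; have := pA (G *m z); rewrite adjmx_mul !mulmxA. Qed.

Lemma hermitian_diagonalization n (H : 'M[C]_n) : H ^t* = H ->
  exists2 P : 'M[C]_n, P ^t* *m P = 1%:M & exists2 D : 'rV[C]_n,
  forall i, D 0 i \is Num.real & H = P ^t* *m diag_mx D *m P.
Proof.
move=> hH; have hs : H \is hermsymmx.
  by rewrite qualifE /= /is_hermsym hH expr0 scale1r.
exists (spectralmx H); last exists (spectral_diag H).
- have := spectral_unitarymx H; rewrite -trmxC_unitary.
  by move/unitarymxP; rewrite trmxCK.
- move=> i; have := hermitian_spectral_diag_real hs => /mxOverP; exact.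
- have /orthomx_spectralP := hermitian_normalmx hs.
  by rewrite invmx_unitary // spectral_unitarymx.
Qed.

Lemma diag_psdmx n (D : 'rV[C]_n) : (forall i, 0 <= D 0 i) ->
  diag_mx D = (diag_mx (map_mx sqrtC D)) ^t* *m diag_mx (map_mx sqrtC D).
Proof.
move=> D0; apply/matrixP => i j; rewrite tr_diag_mx mul_mx_diag !mxE.
case: eqP => [->|_]; last by rewrite !mulr0n rmorph0 mul0r.
by rewrite !mulr1n -normCKC ger0_norm ?sqrtC_ge0 // sqrtCK.
Qed.

Lemma psdmx_gramP n (X : 'M[C]_n) :
  psdmx X -> exists G : 'M[C]_n, X = G ^t* *m G.
Proof.
move=> pX; have [P PP [D _ XE]] := hermitian_diagonalization (psdmx_hermitian pX).
exists (diag_mx (map_mx sqrtC D) *m P).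
rewrite adjmx_mul !mulmxA -[_ *m _ *m diag_mx _]mulmxA -diag_psdmx // => i.
(* Undoing the change of basis shows that [diag_mx D] is positive semidefinite; its form at the
   basis vectors gives [0 <= D 0 i]. *)
have := psdmx_congr (P ^t*) pX.
rewrite XE trmxCK !mulmxA -[P *m _ *m _ *m P *m _]mulmxA (mulmx1C PP) mul1mx mulmx1.
move=> /(_ (delta_mx i 0)); rewrite -mulmxA -colE mxE (bigD1 i) //=.
rewrite big1 => [|l /negPf il]; last by rewrite !mxE il /= rmorph0 mul0r.
by rewrite addr0 !mxE !eqxx rmorph1 mul1r mulr1n.
Qed.

Lemma psdmx_trace_gt0 n (X : 'M[C]_n) : psdmx X -> X != 0 -> 0 < \tr X.
Proof.
move=> /psdmx_gramP[G ->] GN0; rewrite lt_def mxtrace_gram_ge0 andbT.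
by apply: contra_neq GN0 => /mxtrace_gram_eq0 ->; rewrite mulmx0.
Qed.

Lemma hermitian_psd_shift n (H : 'M[C]_n) : H ^t* = H ->
  exists2 K : C, 0 <= K & psdmx (K%:M + H).
Proof.
move=> /hermitian_diagonalization[P PP [D Dr HE]].
pose K := \sum_i `|D 0 i|; have K0 : 0 <= K by apply: sumr_ge0.
exists K => //.
have -> : K%:M + H = P ^t* *m diag_mx (const_mx K + D) *m P.
  by rewrite raddfD /= diag_const_mx mulmxDr mulmxDl -HE mul_mx_scalar
     -scalemxAl PP scalemx1.
apply: psdmx_congr; rewrite diag_psdmx; first exact: psdmx_gram.
move=> i; rewrite !mxE /K (bigD1 i) //= addrAC addr_ge0 ?sumr_ge0 //.
by rewrite -[X in _ + X]opprK subr_ge0 -normrN real_ler_norm ?realN.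
Qed.

End Matrices.

(** * Choi matrices and frames *)

Section Frames.
Variable C : numClosedFieldType.

(** Greedy choice of a basis: [r < N] independent rows have a common nonzero kernel vector [x].
    Totality gives a [psi] in [Psi] not orthogonal to [x], and pairing with [x] shows that [psi] is
    independent of the earlier rows. *)
Lemma total_frame N (Psi : 'cV[C]_N -> Prop) :
  (forall x : 'cV[C]_N, (forall psi, Psi psi -> psi ^t* *m x = 0) -> x = 0) ->
  exists2 G : 'M[C]_N, G \in unitmx & forall i, Psi ((row i G) ^t*).
Proof.
move=> total.
suff /(_ N (leqnn N))[G freeG PG] : forall r, (r <= N)%N -> exists2 G : 'M[C]_(r, N),
    row_free G & forall i, Psi ((row i G) ^t*).
  by exists G; rewrite // -row_free_unit.
elim=> [|r IHr] rN.
  by exists 0 => [|[]//]; apply: inj_row_free => v _; rewrite thinmx0.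
have [G freeG PG] := IHr (ltnW rN).
have [x xN0 Gx0] : exists2 x : 'cV[C]_N, x != 0 & G *m x = 0.
  have : kermx G^T != 0 by rewrite kermx_eq0 -row_leq_rank mxrank_tr
    (eqP freeG) -ltnNge.
  case/rowV0Pn => v /sub_kermxP vG vN0; exists v^T.
    by apply: contra_neq vN0 => /(congr1 trmx); rewrite trmxK trmx0.
  by rewrite -[G]trmxK -trmx_mul vG trmx0.
have [psi Ppsi psixN0] : exists2 psi, Psi psi & psi ^t* *m x != 0.
  apply: contrapT => nopsi; move/eqP: xN0; apply; apply: total => psi Ppsi.
  by apply/eqP; apply: contrapT => /negP ?; apply: nopsi; exists psi.
exists (col_mx (psi ^t*) G : 'M_(1 + r, N)).
  apply: inj_row_free => v; rewrite -[v](@hsubmxK _ 1 1 r).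
  move: (@lsubmx _ 1 1 r v) (@rsubmx _ 1 1 r v) => a w.
  rewrite (@mul_row_col _ 1 1 r N) => v0.
  have a0 : a = 0.
    have /(congr1 (mulmx^~ x)) := v0.
    rewrite mulmxDl -!mulmxA Gx0 mulmx0 addr0 mul0mx [a]mx11_scalar.
    rewrite mul_scalar_mx => /eqP; rewrite scaler_eq0 (negPf psixN0) orbF.
    by move=> /eqP ->; rewrite raddf0.
  move: v0; rewrite a0 mul0mx add0r => /eqP; rewrite mulmx_free_eq0 // => /eqP ->.
  by apply/rowP => j; rewrite mxE; case: splitP => l _; rewrite !mxE.
move=> l; rewrite -[l](@splitK 1 r); case: (@split 1 r l) => j /=.
  by rewrite [j]ord1 (@rowKu _ 1 r) row_id trmxCK.
by rewrite (@rowKd _ 1 r).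
Qed.

(** In the coordinates given by [G] the Gram matrix becomes the identity, and a multiple of the
    identity dominates any Hermitian matrix. *)
Lemma frame_psd_shift N (G H : 'M[C]_N) : G \in unitmx -> H ^t* = H ->
  exists2 K : C, 0 <= K & psdmx (K *: (G ^t* *m G) + H).
Proof.
move=> Gu hH; pose G' := invmx G.
have hH' : (G' ^t* *m H *m G') ^t* = G' ^t* *m H *m G'.
  by rewrite !adjmx_mul trmxCK hH mulmxA.
have [K K0 pK] := hermitian_psd_shift hH'; exists K => //.
have := psdmx_congr G pK; rewrite mulmxDr mulmxDl mul_mx_scalar -scalemxAl.
rewrite !mulmxA -adjmx_mul mulVmx // adjmx1 mul1mx -mulmxA mulVmx //.
by rewrite mulmx1.
Qed.

Lemma gram_rows m n (G : 'M[C]_(m, n)) :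
  G ^t* *m G = \sum_i (row i G) ^t* *m row i G.
Proof.
apply/matrixP => a b; rewrite mxE summxE; apply: eq_bigr => i _.
by rewrite [RHS]mxE big_ord1 !mxE.
Qed.

(** Row-major flattening: [vecm] of [x *m y^T] is the product vector of [x] and [y], and matrix rank
    becomes Schmidt rank. *)
Definition vecm m n (A : 'M[C]_(m, n)) : 'cV[C]_(m * n) :=
  \col_p A (mxtens_unindex p).1 (mxtens_unindex p).2.

Lemma vecmE m n (A : 'M[C]_(m, n)) i a j : vecm A (mxtens_index (i, a)) j = A i a.
Proof. by rewrite mxE mxtens_indexK. Qed.

Lemma vecm_surj m n (x : 'cV[C]_(m * n)) : exists A : 'M[C]_(m, n), x = vecm A.
Proof.
exists (\matrix_(i, a) x (mxtens_index (i, a)) 0).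
by apply/matrixP => p j; case: (mxtens_indexP p) => i a; rewrite vecmE mxE ord1.
Qed.

Lemma big_mxtens m n (F : 'I_(m * n) -> C) :
  \sum_p F p = \sum_i \sum_a F (mxtens_index (i, a)).
Proof.
rewrite pair_bigA /=; apply: reindex; exists (@mxtens_unindex m n) => p _.
  by rewrite -surjective_pairing mxtens_indexK.
by rewrite -surjective_pairing mxtens_unindexK.
Qed.

Lemma vecm_dot m n (A B : 'M[C]_(m, n)) :
  ((vecm A) ^t* *m vecm B) 0 0 = \tr (A ^t* *m B).
Proof.
rewrite mxE big_mxtens exchange_big; apply: eq_bigr => a _; rewrite mxE.
by apply: eq_bigr => i _; rewrite !mxE !mxtens_indexK.
Qed.

Definition tblock m n (M : 'M[C]_(m * n)) (i j : 'I_m) : 'M[C]_n :=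
  \matrix_(a, b) M (mxtens_index (i, a)) (mxtens_index (j, b)).

Lemma tblock_inj m n (M N : 'M[C]_(m * n)) :
  (forall i j, tblock M i j = tblock N i j) -> M = N.
Proof.
move=> MN; apply/matrixP => p q.
case: (mxtens_indexP p) => i a; case: (mxtens_indexP q) => j b.
by have /matrixP/(_ a b) := MN i j; rewrite !mxE.
Qed.

Lemma vecm_sesqui m n (M : 'M[C]_(m * n)) (A B : 'M[C]_(m, n)) :
  ((vecm A) ^t* *m M *m vecm B) 0 0 =
  \sum_i \sum_j (map_mx conjC (row i A) *m tblock M i j *m (row j B)^T) 0 0.
Proof.
rewrite mxE big_mxtens exchange_big.
under eq_bigr => b _ do under eq_bigr => j _ do
  rewrite mxE big_mxtens vecmE mulr_suml.
under [RHS]eq_bigr => i _ do under eq_bigr => j _ do rewrite mxE.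
under [RHS]eq_bigr => i _ do rewrite exchange_big /=.
rewrite [RHS]exchange_big; apply: eq_bigr => b _.
rewrite [RHS]exchange_big; apply: eq_bigr => j _; apply: eq_bigr => i _.
rewrite [in RHS]mxE; congr (_ * _); last by rewrite !mxE.
by apply: eq_bigr => a _; rewrite !mxE mxtens_indexK.
Qed.

Lemma tblock_vecm m n (A B : 'M[C]_(m, n)) i j :
  tblock (vecm A *m (vecm B) ^t*) i j = (row i A)^T *m map_mx conjC (row j B).
Proof.
by apply/matrixP => a b; rewrite !mxE !big_ord1 !mxE !mxtens_indexK.
Qed.

(** The ampliation acts block by block. Since [f] is an arbitrary function, its value on a block
    appears expanded in matrix units. *)
Lemma tblock_tens_map m n (f : 'M[C]_n -> 'M[C]_n) (X : 'M[C]_(m * n)) p q :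
  tblock (tens_map (@idfun 'M[C]_m) f X) p q =
  \sum_i \sum_j tblock X p q i j *: f (delta_mx i j).
Proof.
apply/matrixP => a b; rewrite !mxE !summxE.
rewrite (bigD1 p) //= [X in _ + X]big1 ?addr0 => [|p' /negPf p'p]; last first.
  rewrite summxE big1 // => q' _; rewrite summxE big1 // => i _.
  rewrite summxE big1 // => j _.
  by rewrite mxE tensmxE mxE eq_sym p'p mul0r mulr0.
rewrite summxE (bigD1 q) //= [X in _ + X]big1 ?addr0 => [|q' /negPf q'q]; last first.
  rewrite summxE big1 // => i _; rewrite summxE big1 // => j _.
  by rewrite mxE tensmxE mxE [q == _]eq_sym q'q andbF mul0r mulr0.
rewrite summxE; apply: eq_bigr => i _; rewrite !summxE; apply: eq_bigr => j _.
by rewrite [LHS]mxE tensmxE !mxE !eqxx mul1r.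
Qed.

Lemma tblock_choi d (L : 'M[C]_d -> 'M[C]_d) i j :
  tblock (choi L) i j = d%:R^-1 *: L (delta_mx i j).
Proof.
apply/matrixP => a b; rewrite !mxE; congr (_ * _); rewrite summxE.
rewrite (bigD1 i) //= [X in _ + X]big1 ?addr0 => [|p /negPf pi]; last first.
  rewrite summxE big1 // => q' _; by rewrite tensmxE mxE eq_sym pi mul0r.
rewrite summxE (bigD1 j) //= [X in _ + X]big1 ?addr0 => [|q /negPf qj]; last first.
  by rewrite tensmxE mxE [j == _]eq_sym qj andbF mul0r.
by rewrite tensmxE !mxE !eqxx mul1r.
Qed.

Lemma choi_sesqui d (L : 'M[C]_d -> 'M[C]_d) (A B : 'M[C]_d) :
  ((vecm A) ^t* *m choi L *m vecm B) 0 0 = d%:R^-1 *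
  \sum_i \sum_j (map_mx conjC (row i A) *m L (delta_mx i j) *m (row j B)^T) 0 0.
Proof.
rewrite vecm_sesqui mulr_sumr; apply: eq_bigr => i _; rewrite mulr_sumr.
by apply: eq_bigr => j _; rewrite tblock_choi -scalemxAr -scalemxAl mxE.
Qed.

Lemma choi_inj d (L L' : {linear 'M[C]_d -> 'M[C]_d}) : (0 < d)%N ->
  choi L = choi L' -> L =1 L'.
Proof.
move=> d0 LL' Z; rewrite [Z]matrix_sum_delta !linear_sum.
apply: eq_bigr => i _; rewrite !linear_sum; apply: eq_bigr => j _.
rewrite !linearZ; congr (_ *: _).
have := congr1 (fun M => tblock M i j) LL'; rewrite /= !tblock_choi.
by apply: scalerI; rewrite invr_eq0 pnatr_eq0 -lt0n.
Qed.

(** Since [vecm X] is [X (x) 1] applied to [vecm 1], ampliating its rank-one operator gives [d]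
    times the Choi matrix conjugated by [X (x) 1]; the adjoint of [X (x) 1] sends [vecm H] to the
    vector of [X^H H]. This turns k-positivity into a condition on matrices of rank at most [k]. *)
Lemma ampliation_rank1 d k (L : 'M[C]_d -> 'M[C]_d) (X H K : 'M[C]_(k, d)) :
  (0 < d)%N ->
  ((vecm H) ^t* *m tens_map (@idfun 'M[C]_k) L (vecm X *m (vecm X) ^t*) *m vecm K) 0 0
  = d%:R * ((vecm (X ^t* *m H)) ^t* *m choi L *m vecm (X ^t* *m K)) 0 0.
Proof.
move=> d0; rewrite choi_sesqui mulrA divff ?pnatr_eq0 -?lt0n // mul1r vecm_sesqui.
(* [F] is the common summand; the two sides sum it over the four indices in different orders. *)
pose F p q i j := X p i * (X q j)^* *
  (map_mx conjC (row p H) *m L (delta_mx i j) *m (row q K)^T) 0 0.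
transitivity (\sum_p \sum_q \sum_i \sum_j F p q i j).
  apply: eq_bigr => p _; apply: eq_bigr => q _; rewrite tblock_tens_map.
  rewrite mulmx_sumr mulmx_suml summxE; apply: eq_bigr => i _.
  rewrite mulmx_sumr mulmx_suml summxE; apply: eq_bigr => j _.
  by rewrite -scalemxAr -scalemxAl tblock_vecm [LHS]mxE;
    congr (_ * _); rewrite mxE big_ord1 !mxE.
transitivity (\sum_i \sum_j \sum_p \sum_q F p q i j).
  under eq_bigr => p _ do rewrite exchange_big /=.
  rewrite exchange_big /=; apply: eq_bigr => i _.
  under eq_bigr => p _ do rewrite exchange_big /=.
  by rewrite exchange_big.
apply: eq_bigr => i _; apply: eq_bigr => j _; rewrite !row_mul.
have rowE (N : 'M_(k, d)) l : row l (X ^t*) *m N = \sum_p (X p l)^* *: row p N.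
  by rewrite mulmx_sum_row; apply: eq_bigr => p _; rewrite !mxE.
rewrite !rowE map_mx_sum mulmx_suml mulmx_suml summxE; apply: eq_bigr => p _.
rewrite linear_sum mulmx_sumr summxE; apply: eq_bigr => q _.
rewrite /= linearZ map_mxZ /= conjCK -!scalemxAl -scalemxAr.
by rewrite [RHS]mxE [X in _ = _ * X]mxE mulrA.
Qed.

End Frames.

(** * Positivity, partial transposition and detection *)

Section Positivity.
Variable C : numClosedFieldType.

Lemma tens_map_linear m n (f : 'M[C]_n -> 'M[C]_n) :
  linear (tens_map (@idfun 'M[C]_m) f).
Proof.
move=> a X Y; apply: tblock_inj => p q.
transitivity (a *: tblock (tens_map (@idfun 'M[C]_m) f X) p q +
              tblock (tens_map (@idfun 'M[C]_m) f Y) p q); last first.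
  by apply/matrixP => i j; rewrite !mxE.
rewrite !tblock_tens_map scaler_sumr -big_split; apply: eq_bigr => i _.
rewrite scaler_sumr -big_split; apply: eq_bigr => j _ /=.
by rewrite !mxE scalerDl scalerA.
Qed.

HB.instance Definition _ m n (f : 'M[C]_n -> 'M[C]_n) :=
  GRing.isLinear.Build C 'M[C]_(m * n) 'M[C]_(m * n) _ (tens_map (@idfun 'M[C]_m) f)
    (@tens_map_linear m n f).

Definition ptrans m n : 'M[C]_(m * n) -> 'M[C]_(m * n) :=
  tens_map (@idfun 'M[C]_m) (@trmx C n n).

HB.instance Definition _ m n := GRing.Linear.on (@ptrans m n).

Lemma tblock_ptrans m n (X : 'M[C]_(m * n)) i j :
  tblock (ptrans X) i j = (tblock X i j)^T.
Proof.
rewrite tblock_tens_map [in RHS](matrix_sum_delta (tblock X i j)) linear_sum.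
by apply: eq_bigr => a _; rewrite linear_sum; apply: eq_bigr => b _; rewrite linearZ.
Qed.

Lemma ptransK m n : involutive (@ptrans m n).
Proof. by move=> X; apply: tblock_inj => i j; rewrite !tblock_ptrans trmxK. Qed.

Lemma ptrans_hermitian m n (X : 'M[C]_(m * n)) :
  X ^t* = X -> (ptrans X) ^t* = ptrans X.
Proof.
have adj_tblock (Y : 'M[C]_(m * n)) i j : tblock (Y ^t*) i j = (tblock Y j i) ^t*.
  by apply/matrixP => a b; rewrite !mxE.
move=> hX; apply: tblock_inj => i j.
rewrite adj_tblock !tblock_ptrans -[in RHS]hX adj_tblock.
by apply/matrixP => a b; rewrite !mxE.
Qed.

(** Transposing a rank-one operator conjugates its vector, so only the second tensor factor
    changes. *)
Lemma ptrans_product m n (x : 'cV[C]_m) (y : 'cV[C]_n) :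
  ptrans (vecm (x *m y ^t*) *m (vecm (x *m y ^t*)) ^t*) =
  vecm (x *m y^T) *m (vecm (x *m y^T)) ^t*.
Proof.
apply: tblock_inj => i j; rewrite tblock_ptrans !tblock_vecm.
apply/matrixP => a b; rewrite !mxE !big_ord1 !mxE !big_ord1 !mxE.
by rewrite !rmorphM /= !conjCK; ring.
Qed.

Lemma k_positive_choi_ge0 d k (L : 'M[C]_d -> 'M[C]_d)
  (M : 'M[C]_(d, k)) (N : 'M[C]_(k, d)) : (0 < d)%N -> k_positive k L ->
  0 <= ((vecm (M *m N)) ^t* *m choi L *m vecm (M *m N)) 0 0.
Proof.
move=> d0 Lk; rewrite -(@pmulr_rge0 _ d%:R) ?ltr0n //.
rewrite -[M]trmxCK -ampliation_rank1 //; apply: Lk.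
by rewrite -{1}[vecm _]trmxCK; apply: psdmx_gram.
Qed.

(** By the Gram decomposition it suffices to test rank-one inputs, where [ampliation_rank1] produces
    exactly the matrices that factor through dimension [k]. *)
Lemma choi_ge0_k_positive d k (L : 'M[C]_d -> 'M[C]_d) : (0 < d)%N ->
  (forall (M : 'M[C]_(d, k)) (N : 'M[C]_(k, d)),
    0 <= ((vecm (M *m N)) ^t* *m choi L *m vecm (M *m N)) 0 0) ->
  k_positive k L.
Proof.
move=> d0 Lge0 X /psdmx_gramP[G ->] x; have [H ->] := vecm_surj x.
rewrite gram_rows [tens_map _ _ _]linear_sum mulmx_sumr mulmx_suml summxE /=.
apply: sumr_ge0 => i _; have [Y YE] := vecm_surj ((row i G) ^t*).
have -> : row i G = (vecm Y) ^t* by rewrite -YE trmxCK.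
by rewrite trmxCK ampliation_rank1 // pmulr_rge0 ?ltr0n.
Qed.

(* Adding to a Hermitian [H] large multiples of [S] and [R] makes it PPT, and
   does not change the value of [W]. *)
Lemma detection_transfer d (W W' S R H : 'M[C]_(d * d)) :
  (forall H : 'M[C]_(d * d), H ^t* = H -> exists2 K, 0 <= K & psdmx (K *: S + H)) ->
  (forall H : 'M[C]_(d * d), H ^t* = H ->
    exists2 K, 0 <= K & psdmx (K *: ptrans R + H)) ->
  psdmx S -> psdmx R ->
  \tr (S *m W) = 0 -> \tr (R *m W) = 0 ->
  0 <= \tr (S *m W') -> 0 <= \tr (R *m W') ->
  (forall rho, ppt rho -> \tr (rho *m W) < 0 -> \tr (rho *m W') < 0) ->
  H ^t* = H -> \tr (H *m W) < 0 -> \tr (H *m W') < 0.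
Proof.
move=> Sint Rint pS pR SW RW SW' RW' det hH HW.
have [K1 K1ge0 pSH] := Sint _ hH.
(* The first shift makes the matrix positive semidefinite. The second repairs the partial transpose
   and preserves positivity, because [R] is itself positive semidefinite. *)
have [K2 K2ge0 pR'] := Rint _ (ptrans_hermitian (psdmx_hermitian pSH)).
pose rho := K2 *: R + (K1 *: S + H).
have trE M : \tr (rho *m M) = K2 * \tr (R *m M) + (K1 * \tr (S *m M) + \tr (H *m M)).
  by rewrite !mulmxDl -!scalemxAl !mxtraceD !mxtraceZ.
have prho : psdmx rho by apply: psdmxD => //; apply: psdmxZ.
have rhoW : \tr (rho *m W) < 0 by rewrite trE SW RW !mulr0 !add0r.
have rho_gt0 : 0 < \tr rho.
  apply: psdmx_trace_gt0 => //; apply: contraTneq rhoW => ->.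
  by rewrite mul0mx mxtrace0 ltxx.
have /det : ppt ((\tr rho)^-1 *: rho).
  split; last first.
    rewrite -/(@ptrans d d _) linearZ; apply: psdmxZ; first by rewrite invr_ge0 ltW.
    by rewrite linearD linearZ.
  split; first by apply: psdmxZ => //; rewrite invr_ge0 ltW.
  by rewrite mxtraceZ mulVf // gt_eqF.
rewrite -!scalemxAl !mxtraceZ !pmulr_rlt0 ?invr_gt0 // => /(_ rhoW).
by rewrite trE; apply: le_lt_trans; rewrite addrA lerDr addr_ge0 // mulr_ge0.
Qed.

(** Subtracting a multiple of [H0] from a Hermitian [X] gives [Y] in the kernel of [W]. On the whole
    real line [H0 + s Y] the functional of [W] is negative, hence so is that of [W']; an affine
    function negative on a line is constant, so [Y] is in the kernel of [W'] too. *)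
Lemma functional_proportional n (W W' : 'M[C]_n) (x0 : 'cV[C]_n) :
  W ^t* = W -> (x0 ^t* *m W *m x0) 0 0 < 0 ->
  (forall H : 'M[C]_n, H ^t* = H -> \tr (H *m W) < 0 -> \tr (H *m W') < 0) ->
  exists2 c : C, 0 < c & W' = c *: W.
Proof.
move=> hW x0W WW'; pose f M (H : 'M[C]_n) : C := \tr (H *m M).
have trE (M : 'M[C]_n) (x : 'cV[C]_n) : (x ^t* *m M *m x) 0 0 = f M (x *m x ^t*).
  by rewrite sesqui_mxtrace mxtrace_mulC.
have fD M A B : f M (A + B) = f M A + f M B by rewrite /f mulmxDl mxtraceD.
have fZ M c A : f M (c *: A) = c * f M A by rewrite /f -scalemxAl mxtraceZ.
have herm (x : 'cV[C]_n) : (x *m x ^t*) ^t* = x *m x ^t* by rewrite adjmx_mul trmxCK.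
move: x0W; rewrite trE; set H0 := x0 *m x0 ^t* => H0W.
have H0W' : f W' H0 < 0 by apply: WW' => //; apply: herm.
exists (f W' H0 / f W H0); first by rewrite nmulr_rgt0 // invr_lt0.
apply: quadratic_form_inj => x; rewrite -scalemxAr -scalemxAl [RHS]mxE !trE.
set X := x *m x ^t*; have fWr : f W X \is Num.real.
  by rewrite -trE; apply: hermitian_form_real.
have H0r : f W H0 \is Num.real by apply: ltr0_real.
pose c := f W X / f W H0; have cr : c \is Num.real by apply: rpred_div.
pose Y := X - c *: H0.
have fWY : f W Y = 0.
  by rewrite /Y -scaleNr fD fZ mulNr divfK ?subrr // lt_eqF.
have hY : Y ^t* = Y.
  by rewrite adjmxD adjmxN adjmxZ !herm (CrealP cr).
have line s : s \is Num.real -> f W' H0 + s * f W' Y < 0.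
  move=> sr; rewrite -fZ -fD; apply: WW'.
    by rewrite adjmxD adjmxZ hY herm (CrealP sr).
  by rewrite -/(f _ _) fD fZ fWY mulr0 addr0.
have fW'Y : f W' Y = 0.
  apply/eqP; apply: contraT => YN0.
  (* Negative elements are real, so the values at [s = 0] and [s = 1] give the reality of their
     difference. *)
  have Yr : f W' Y \is Num.real.
    have := ltr0_real (line 1 (rpred1 _)); rewrite mul1r => sr.
    by rewrite -[f W' Y](addKr (f W' H0)) rpredD ?rpredN // ltr0_real.
  (* This [s] is the root of the affine function, where it cannot be negative. *)
  have := line (- f W' H0 / f W' Y); rewrite divfK // subrr ltxx; apply.
  by rewrite rpred_div ?rpredN ?(ltr0_real H0W').
have : f W' X = c * f W' H0 by rewrite -[X](subrK (c *: H0)) fD fW'Y add0r fZ.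
by move=> ->; rewrite /c [LHS]mulrC [LHS]mulrA mulrAC.
Qed.

End Positivity.

(** * The Breuer-Hall form *)

Section BreuerHall.
Variables (C : numClosedFieldType) (d : nat) (V : 'M[C]_d).
Hypotheses (d_gt0 : (0 < d)%N) (V_unitary : V \is unitarymx) (V_skew : V^T = - V).

Let adjVV : V ^t* *m V = 1%:M.
Proof. exact/mulmx1C/unitarymxP. Qed.

Lemma row_delta_col n (u : 'rV[C]_n) (w : 'cV[C]_n) i j :
  (u *m delta_mx i j *m w) 0 0 = u 0 i * w j 0.
Proof.
rewrite -(mul_delta_mx (0 : 'I_1)) mulmxA -colE -mulmxA -rowE.
by rewrite mxE big_ord1 !mxE.
Qed.

Lemma mxtrace_delta n i j : \tr (delta_mx i j : 'M[C]_n) = (i == j)%:R.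
Proof.
rewrite -(mul_delta_mx (0 : 'I_1)) mxtrace_mulC mul_delta_mx_cond.
by rewrite raddfMn /= trace_mx11 mxE !eqxx eq_sym.
Qed.

Lemma choi_BHmap k (A : 'M[C]_d) :
  ((vecm A) ^t* *m choi (BHmap k V) *m vecm A) 0 0 =
  d%:R^-1 * (k%:R * d%:R - k%:R - 1)^-1 * (k%:R * \tr (A ^t* *m A) -
    `|\tr A| ^+ 2 - k%:R * \tr (A ^t* *m V ^t* *m A^T *m V^T)).
Proof.
rewrite choi_sesqui -mulrA; congr (_ * _).
pose row_ i := map_mx conjC (row i A).
transitivity (\sum_i \sum_j (k%:R * d%:R - k%:R - 1)^-1 * (k%:R * ((i == j)%:R *
    (row_ i *m (row j A)^T) 0 0) - (A i i)^* * A j j -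
    k%:R * ((map_mx conjC A *m V) i j * (V ^t* *m A^T) i j))).
  apply: eq_bigr => i _; apply: eq_bigr => j _.
  rewrite -/(row_ i) /BHmap -scalemxAr -scalemxAl [LHS]mxE; congr (_ * _).
  rewrite !mulmxBr !mulmxBl -scalemxAr -scalemxAl trmx_delta.
  rewrite !mxBE [X in _ - X]mxE; congr (_ - _ - _ * _).
  - rewrite mul_mx_scalar -scalemxAl mxE -mulrA; congr (_ * (_ * _)).
    exact: mxtrace_delta.
  - by rewrite row_delta_col !mxE.
  - rewrite !mulmxA -[_ *m V ^t* *m _]mulmxA row_delta_col; congr (_ * _).
      by rewrite !mxE; apply: eq_bigr => l _; rewrite !mxE.
    by rewrite !mxE; apply: eq_bigr => l _; rewrite !mxE.
under eq_bigr => i _ do rewrite -mulr_sumr.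
rewrite -mulr_sumr; congr (_ * _).
under eq_bigr => i _ do rewrite !sumrB -!mulr_sumr.
rewrite !sumrB -!mulr_sumr; congr (_ * _ - _ - _ * _).
- rewrite mxtrace_mulC; apply: eq_bigr => i _.
  rewrite (bigD1 i) //= big1 ?addr0 => [|j /negPf ji]; last first.
    by rewrite eq_sym ji mul0r.
  rewrite eqxx mul1r !mxE; apply: eq_bigr => l _; rewrite !mxE mulrC //.
- by rewrite normCKC rmorph_sum mulr_suml; apply: eq_bigr.
- transitivity (\tr (map_mx conjC A *m V *m (V ^t* *m A^T)^T)).
    by apply: eq_bigr => i _; rewrite mxE; apply: eq_bigr => j _; rewrite [_^T _ _]mxE.
  rewrite -mxtrace_tr !trmx_mul !trmxK map_trmx mxtrace_mulC !mulmxA.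
  by rewrite -!mulmxA mxtrace_mulC -!mulmxA mxtrace_mulC !mulmxA.
Qed.

(* With [B = V A], the form only sees the skew part of [B]; this is where
   [V^T = - V] enters. *)
Lemma choi_BHmap_skew k (A : 'M[C]_d) : let T := V *m A - (V *m A)^T in
  ((vecm A) ^t* *m choi (BHmap k V) *m vecm A) 0 0 =
  d%:R^-1 * (k%:R * d%:R - k%:R - 1)^-1 *
    (2^-1 * k%:R * \tr (T ^t* *m T) - 4^-1 * `|\tr (V ^t* *m T)| ^+ 2).
Proof.
move=> T; rewrite choi_BHmap; congr (_ * _).
set B := V *m A in T *; have AE : A = V ^t* *m B by rewrite mulmxA adjVV mul1mx.
have -> : \tr (A ^t* *m A) = \tr (B ^t* *m B).
  by rewrite adjmx_mul -mulmxA -/B -[in RHS]AE.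
have -> : \tr (A ^t* *m V ^t* *m A^T *m V^T) = \tr (B ^t* *m B^T).
  by rewrite adjmx_mul trmx_mul !mulmxA.
(* The factor 2 here gives the constant 1/2. In [trV] the skewness of [V^H] makes both halves of [T]
   contribute [\tr A], and squaring gives the 1/4. *)
have trT : \tr (T ^t* *m T) = 2 * (\tr (B ^t* *m B) - \tr (B ^t* *m B^T)).
  rewrite /T adjmxD adjmxN mulmxDl !mulmxDr !mulNmx !mulmxN opprK.
  have e : \tr (B^T ^t* *m B) = \tr (B ^t* *m B^T).
    by rewrite -mxtrace_tr trmx_mul map_trmx mxtrace_mulC trmxK.
  rewrite !(mxtraceD, raddfN) /= e.
  have -> : \tr (B^T ^t* *m B^T) = \tr (B ^t* *m B).
    by rewrite -mxtrace_tr trmx_mul trmxK map_trmx mxtrace_mulC.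
  ring.
have trV : \tr (V ^t* *m T) = 2 * \tr A.
  rewrite /T mulmxBr raddfB /= -AE -[\tr (_ *m B^T)]mxtrace_tr trmx_mul trmxK.
  have -> : (V ^t*)^T = - V ^t* by rewrite [in LHS]V_skew map_mxN linearN /= map_trmx.
  by rewrite mulmxN raddfN /= mxtrace_mulC -AE opprK mulr_natl mulr2n.
rewrite trT trV normrM exprMn ger0_norm ?ler0n //.
by field.
Qed.

Lemma choi_BHmap_hermitian k : (choi (BHmap k V)) ^t* = choi (BHmap k V).
Proof.
apply: real_form_hermitian => x; have [A ->] := vecm_surj x.
rewrite choi_BHmap_skew rpredM ?rpredB //.
- by rewrite rpredM ?rpredV ?rpredB ?rpredM ?real1 ?realn.
- by rewrite !rpredM ?rpredV ?realn // ger0_real ?mxtrace_gram_ge0.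
- by rewrite rpredM ?rpredV ?realn // rpredX // normr_real.
Qed.

(** Factor [T = D S], where the rows of [S] are an orthonormal basis of the row space. Then [D] has
    the norm of [T], the squared norm of [V S^H] is the rank of [T], and Cauchy-Schwarz applies to
    these two. *)
Lemma mxtrace_rank_bound r (T : 'M[C]_d) : (\rank T <= r)%N ->
  `|\tr (V ^t* *m T)| ^+ 2 <= r%:R * \tr (T ^t* *m T).
Proof.
move=> rT; apply: (@le_trans _ _ ((\rank T)%:R * \tr (T ^t* *m T))); last first.
  by rewrite ler_wpM2r ?mxtrace_gram_ge0 // ler_nat.
pose S := schmidt (row_base T).
have SS : S *m S ^t* = 1%:M by apply/unitarymxP/schmidt_unitarymx/rank_leq_col.
have /submxP[D DE] : (T <= S)%MS.
  by rewrite eqmx_schmidt_free ?row_base_free // eq_row_base.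
have := mxtrace_cauchy_schwarz (V *m S ^t*) D.
rewrite !adjmx_mul trmxCK -!mulmxA [V ^t* *m (V *m _)]mulmxA adjVV mul1mx SS mxtrace1.
rewrite mxtrace_mulC -mulmxA -DE.
have -> // : \tr (T ^t* *m T) = \tr (D ^t* *m D).
transitivity (\tr ((D *m S) ^t* *m (D *m S))); first by rewrite -DE.
by rewrite adjmx_mul -mulmxA mxtrace_mulC -!mulmxA SS mulmx1.
Qed.

Lemma BHmap_k_positive k : (0 <= (k%:R * d%:R - k%:R - 1 : C)) ->
  k_positive k (BHmap k V).
Proof.
move=> c0; apply: choi_ge0_k_positive => // M N.
rewrite choi_BHmap_skew mulr_ge0 ?mulr_ge0 ?invr_ge0 ?ler0n //.
set B := V *m (M *m N); set T := B - B^T.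
have rB : (\rank B <= k)%N.
  apply: leq_trans (mxrankM_maxr _ _) _; apply: leq_trans (mxrankM_maxl _ _) _.
  exact: rank_leq_col.
have rT : (\rank T <= k + k)%N.
  apply: leq_trans (mxrank_add _ _) _.
  by rewrite mxrank_opp mxrank_tr leq_add.
have := mxtrace_rank_bound rT; rewrite subr_ge0 natrD => bound.
have -> : 2^-1 * k%:R * \tr (T ^t* *m T) =
    4^-1 * ((k%:R + k%:R) * \tr (T ^t* *m T)) by field.
by rewrite ler_wpM2l // invr_ge0 ler0n.
Qed.

(** The second condition uses the transpose: it concerns the bilinear form of [V], not a Hermitian
    one. *)
Definition isotropic m (Z : 'M[C]_(d, m)) :=
  Z ^t* *m Z = 1%:M /\ Z^T *m V *m Z = 0.

(** For the rank [m] projection [Z Z^H] the first two terms of the form are [k m] and [m^2]; the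
    third contains the adjoint of [Z^T V Z] and vanishes. *)
Lemma choi_BHmap_isotropic k m (Z : 'M[C]_(d, m)) : isotropic Z ->
  ((vecm (Z *m Z ^t*)) ^t* *m choi (BHmap k V) *m vecm (Z *m Z ^t*)) 0 0 =
  d%:R^-1 * (k%:R * d%:R - k%:R - 1)^-1 * (m%:R * (k%:R - m%:R)).
Proof.
move=> [ZZ ZVZ]; rewrite choi_BHmap; congr (_ * _).
have trZ : \tr (Z *m Z ^t*) = m%:R by rewrite mxtrace_mulC ZZ mxtrace1.
rewrite adjmx_mul trmxCK -mulmxA [Z ^t* *m (Z *m _)]mulmxA ZZ mul1mx trZ.
rewrite trmx_mul -!mulmxA [Z ^t* *m (V ^t* *m _)]mulmxA.
have -> : Z ^t* *m V ^t* *m ((Z ^t*)^T *m (Z^T *m V^T)) = 0.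
  have := congr1 (fun M => M ^t*) ZVZ; rewrite !adjmx_mul trmx0 map_mx0 mulmxA.
  have -> : (Z ^t*)^T = Z^T ^t* by rewrite map_trmx.
  by rewrite !mulmxA => ->; rewrite !mul0mx.
rewrite mulmx0 mxtrace0 mulr0 subr0 ger0_norm ?ler0n //; ring.
Qed.

Lemma choi_BHmap_symmetric k (z : 'cV[C]_d) :
  ((vecm (z *m (V *m z)^T)) ^t* *m choi (BHmap k V) *m vecm (z *m (V *m z)^T)) 0 0 = 0.
Proof.
rewrite choi_BHmap_skew mulmxA; move: (V *m z) => w.
(* [V A] is here the symmetric matrix [w w^T], so its skew part is zero. *)
rewrite trmx_mul trmxK subrr mulmx0 mxtrace0.
by rewrite mulmx0 mxtrace0 normr0 expr0n /= !mulr0 subrr mulr0.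
Qed.

Lemma skew_form_alternating (w : 'cV[C]_d) : w^T *m V *m w = 0.
Proof.
apply/matrixP => i j; rewrite !ord1.
have /matrixP/(_ 0 0) : (w^T *m V *m w)^T = - (w^T *m V *m w).
  by rewrite !trmx_mul trmxK V_skew mulNmx mulmxN mulmxA.
rewrite mxE [RHS]mxE => /eqP; rewrite -addr_eq0 -mulr2n mulrn_eq0 => /eqP ->.
by rewrite mxE.
Qed.

(** Orthogonality to the columns of [Z], in both senses, is [2m] linear equations in [d > 2m]
    unknowns. A normalized solution works, as it is isotropic by itself. *)
Lemma isotropic_extend m (Z : 'M[C]_(d, m)) : (m + m < d)%N -> isotropic Z ->
  exists w : 'cV[C]_d, isotropic (row_mx w Z).
Proof.
move=> md [ZZ ZVZ].
have : kermx (col_mx (Z ^t*) (Z^T *m V))^T != 0.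
  rewrite kermx_eq0 -row_leq_rank -ltnNge mxrank_tr.
  exact: leq_ltn_trans (rank_leq_row _) md.
case/rowV0Pn => v /sub_kermxP vK vN0.
have : col_mx (Z ^t*) (Z^T *m V) *m v^T = 0.
  by rewrite -[col_mx _ _]trmxK -trmx_mul vK trmx0.
rewrite mul_col_mx => /eqP; rewrite col_mx_eq0 => /andP[/eqP Zv /eqP ZVv].
have u_ge0 := mxtrace_gram_ge0 v^T; set a := \tr _ in u_ge0.
have aN0 : a != 0.
  by apply: contra_neq vN0 => /mxtrace_gram_eq0/(congr1 trmx); rewrite trmxK trmx0.
pose w := (sqrtC a)^-1 *: v^T; exists w.
have ww : w ^t* *m w = 1%:M.
  rewrite adjmxZ -scalemxAl -scalemxAr scalerA [_ *m _]mx11_scalar -trace_mx11 -/a.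
  rewrite scale_scalar_mx; congr (_%:M).
  rewrite geC0_conj ?invr_ge0 ?sqrtC_ge0 // -invfM -expr2 sqrtCK mulVf //.
have Zw : Z ^t* *m w = 0 by rewrite -scalemxAr Zv scaler0.
have ZVw : Z^T *m V *m w = 0 by rewrite -scalemxAr ZVv scaler0.
split.
  rewrite tr_row_mx map_col_mx mul_col_row ww ZZ Zw.
  have -> : w ^t* *m Z = 0 by rewrite -[Z]trmxCK -adjmx_mul Zw trmx0 map_mx0.
  by rewrite -scalar_mx_block.
rewrite tr_row_mx mul_col_mx mul_col_row skew_form_alternating ZVZ ZVw.
have -> : w^T *m V *m Z = 0.
  apply: trmx_inj; rewrite trmx0 !trmx_mul trmxK V_skew mulNmx mulmxN mulmxA.
  by rewrite ZVw oppr0.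
exact: block_mx0.
Qed.

(** The bound amounts to [2(m+1) <= d], and [Z] has [m+1] columns. Start from [z] alone and adjoin
    columns. *)
Lemma isotropic_through m (z : 'cV[C]_d) : (m.*2.+1 < d)%N -> z ^t* *m z = 1%:M ->
  exists2 Z : 'M[C]_(d, m.+1), isotropic Z & exists l, col l Z = z.
Proof.
move=> + zz; elim: m => [|m IHm] md.
  exists z; first by split=> //; apply: skew_form_alternating.
  by exists 0; rewrite col_id.
have [|Z isoZ [l lZ]] := IHm.
  by apply: leq_trans md; rewrite doubleS; do 2!apply: leqW.
have [|w isow] := isotropic_extend _ isoZ.
  by rewrite addnn (leq_trans _ md) // doubleS.
exists (row_mx w Z) => //; exists (rshift 1 l).
by rewrite (@colKr _ _ 1).
Qed.

Lemma isotropic_exists m : (m.*2.+1 < d)%N ->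
  exists Z : 'M[C]_(d, m.+1), isotropic Z.
Proof.
move=> md; pose e := delta_mx (Ordinal d_gt0) 0 : 'cV[C]_d.
have ee : e ^t* *m e = 1%:M.
  rewrite /e trmx_delta map_delta_mx mul_delta_mx.
  by apply/matrixP => i j; rewrite !ord1 !mxE.
by have [Z isoZ _] := isotropic_through md ee; exists Z.
Qed.

Lemma isotropic_col' m (Z : 'M[C]_(d, m.+1)) l : isotropic Z -> isotropic (col' l Z).
Proof.
have sub (Y M : 'M[C]_(d, m.+1)) (W : 'M[C]_d) :
    (col' l Y)^T *m W *m col' l M = mxsub (lift l) (lift l) (Y^T *m W *m M).
  apply/matrixP => a b; rewrite !mxE; apply: eq_bigr => i _; rewrite !mxE.
  by congr (_ * _); apply: eq_bigr => j _; rewrite !mxE.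
move=> [ZZ ZVZ]; split; last by rewrite sub ZVZ; apply/matrixP => i j; rewrite !mxE.
have := sub (map_mx conjC Z) Z 1%:M; rewrite !mulmx1.
have -> : (map_mx conjC Z)^T = Z ^t* by rewrite map_trmx.
rewrite ZZ.
have -> : (col' l (map_mx conjC Z))^T = (col' l Z) ^t*.
  by apply/matrixP => i j; rewrite !mxE.
by move=> ->; apply/matrixP => i j; rewrite !mxE (inj_eq lift_inj).
Qed.

End BreuerHall.

(** * Optimality *)

Section Optimality.
Variable C : numClosedFieldType.

Lemma unit_vector_polarization n (M : 'M[C]_n) :
  (forall z : 'cV[C]_n, z ^t* *m z = 1%:M -> (z ^t* *m M *m z) 0 0 = 0) -> M = 0.
Proof.
move=> M0; apply: quadratic_polarization => z.
have [->|zN0] := eqVneq z 0; first by rewrite mulmx0 mxE.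
have a_ge0 := mxtrace_gram_ge0 z; set a := \tr _ in a_ge0.
have aN0 : a != 0 by apply: contra_neq zN0 => /mxtrace_gram_eq0.
have sN0 : sqrtC a != 0 by rewrite sqrtC_eq0.
pose w := (sqrtC a)^-1 *: z.
have -> : z = sqrtC a *: w by rewrite scalerA divff // scale1r.
rewrite adjmxZ -!scalemxAl -scalemxAr !mxZE M0 ?mulr0 //.
rewrite adjmxZ -scalemxAl -scalemxAr scalerA [_ *m _]mx11_scalar -trace_mx11 -/a.
rewrite scale_scalar_mx; congr (_%:M).
by rewrite geC0_conj ?invr_ge0 ?sqrtC_ge0 // -invfM -expr2 sqrtCK mulVf.
Qed.

Lemma psdmx_form_kernel n (M : 'M[C]_n) (x : 'cV[C]_n) :
  psdmx M -> (x ^t* *m M *m x) 0 0 = 0 -> M *m x = 0.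
Proof.
move=> /psdmx_gramP[G ->]; rewrite mulmxA -adjmx_mul -mulmxA -trace_mx11.
by move=> /mxtrace_gram_eq0 Gx; rewrite -mulmxA Gx mulmx0.
Qed.

Lemma k_positive_rank1_ge0 d k (L : 'M[C]_d -> 'M[C]_d) (x : 'cV[C]_d) (y : 'rV[C]_d) :
  (0 < d)%N -> (0 < k)%N -> k_positive k L ->
  0 <= ((vecm (x *m y)) ^t* *m choi L *m vecm (x *m y)) 0 0.
Proof.
case: k => // k d0 _ Lk.
(* Padding by zeros raises the inner dimension of the factorization from 1 to [1 + k]. *)
have := @k_positive_choi_ge0 _ d (1 + k) L (row_mx x 0) (col_mx y 0) d0 Lk.
by rewrite mul_row_col mul0mx addr0.
Qed.

(* [x *m y^T + u *m v^T] has rank at most 2, so that a zero of the quadratic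
   form at a product vector is a minimum along all product directions. *)
Lemma k_positive_product_kernel d k (L : 'M[C]_d -> 'M[C]_d) (x y : 'cV[C]_d) :
  (0 < d)%N -> k_positive k.+2 L ->
  ((vecm (x *m y^T)) ^t* *m choi L *m vecm (x *m y^T)) 0 0 = 0 ->
  choi L *m vecm (x *m y^T) = 0.
Proof.
move=> d0 Lk xy0; have dN0 : d%:R != 0 :> C by rewrite pnatr_eq0 -lt0n.
suff uv0 (u v : 'cV[C]_d) :
    ((vecm (u *m v^T)) ^t* *m choi L *m vecm (x *m y^T)) 0 0 = 0.
  apply/matrixP => p q; rewrite ord1 [RHS]mxE; case: (mxtens_indexP p) => i a.
  rewrite -[RHS](uv0 (delta_mx i 0) (delta_mx a 0)) -mulmxA.
  rewrite trmx_delta mul_delta_mx.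
  have -> : vecm (delta_mx i a : 'M[C]_d) = delta_mx (mxtens_index (i, a)) 0.
    apply/matrixP => r s; case: (mxtens_indexP r) => j b; rewrite vecmE !mxE.
    by rewrite (can_eq (@mxtens_indexK d d)) xpair_eqE ord1 eqxx andbT.
  by rewrite trmx_delta map_delta_mx -rowE !mxE.
(* With columns [x] and [u] in one [M], the factors [N] and [N'] select the two products while the
   ampliated operator [P] stays the same. A zero of the form of [P] at [N] is then a kernel vector,
   which kills the cross term with [N']. *)
pose M : 'M[C]_(d, 1 + (1 + k)) := row_mx x (row_mx u 0).
pose N : 'M[C]_(1 + (1 + k), d) := col_mx y^T (col_mx 0 0).
pose N' : 'M[C]_(1 + (1 + k), d) := col_mx 0 (col_mx v^T 0).
have MN : M *m N = x *m y^T by rewrite !mul_row_col !mulmx0 !addr0.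
have MN' : M *m N' = u *m v^T by rewrite !mul_row_col !mulmx0 addr0 add0r.
pose P := tens_map (@idfun 'M[C]_(1 + (1 + k))) L (vecm (M ^t*) *m (vecm (M ^t*)) ^t*).
have pP : psdmx P.
  by apply: (Lk); rewrite -{1}[vecm (M ^t*)]trmxCK; apply: psdmx_gram.
have : ((vecm N) ^t* *m P *m vecm N) 0 0 = 0.
  by rewrite ampliation_rank1 // trmxCK MN xy0 mulr0.
move=> /(psdmx_form_kernel pP) PN.
have := @ampliation_rank1 _ d _ L (M ^t*) N' N d0.
rewrite -mulmxA -/P PN mulmx0 mxE trmxCK MN MN' => /esym/eqP.
by rewrite mulf_eq0 (negPf dN0) => /eqP.
Qed.

(** Each summand is a scalar, hence equal to its transpose; transposing exchanges [y] with its
    conjugate. *)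
Lemma choi_trmx_product d (L : 'M[C]_d -> 'M[C]_d) (x y : 'cV[C]_d) :
  ((vecm (x *m y^T)) ^t* *m choi (trmx \o L) *m vecm (x *m y^T)) 0 0 =
  ((vecm (x *m y ^t*)) ^t* *m choi L *m vecm (x *m y ^t*)) 0 0.
Proof.
rewrite !choi_sesqui; congr (_ * _); apply: eq_bigr => i _; apply: eq_bigr => j _.
have row_outer (w : 'rV[C]_d) l : row l (x *m w) = x l 0 *: w.
  by apply/rowP => a; rewrite !mxE big_ord1.
rewrite !row_outer !map_mxZ /= ![(_ *: _)^T]linearZ /= -!scalemxAl.
rewrite -!scalemxAr !mxZE.
congr (_ * (_ * _)); rewrite trmxK map_mxCK -[LHS]trace_mx11 -[RHS]trace_mx11.
by rewrite -mxtrace_tr !trmx_mul !trmxK map_trmx mulmxA.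
Qed.

Lemma choi_eq0 d (L : {linear 'M[C]_d -> 'M[C]_d}) Z : (0 < d)%N ->
  choi L = 0 -> L Z = 0.
Proof.
move=> d0 L0; have := @choi_inj _ d L (\0 : 'M[C]_d -> 'M[C]_d) d0.
apply; rewrite L0; apply: tblock_inj => i j; rewrite tblock_choi /= scaler0.
by apply/matrixP => a b; rewrite !mxE.
Qed.

Lemma eq_choi d (L L' : 'M[C]_d -> 'M[C]_d) : L =1 L' -> choi L = choi L'.
Proof. by move=> LL'; apply: tblock_inj => i j; rewrite !tblock_choi LL'. Qed.

Lemma choiD d (L L' : 'M[C]_d -> 'M[C]_d) :
  choi (fun Z => L Z + L' Z) = choi L + choi L'.
Proof.
apply: tblock_inj => i j; rewrite tblock_choi scalerDr -!tblock_choi.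
by apply/matrixP => a b; rewrite !mxE.
Qed.

Variables (d : nat) (V : 'M[C]_d).
Hypotheses (d_gt0 : (0 < d)%N) (V_unitary : V \is unitarymx) (V_skew : V^T = - V).

(** Extend a unit vector [z] to [k+1] isotropic columns. Deleting any one leaves an admissible
    frame, so every diagonal entry of [Z^H X Z] equals its trace [s]. Then [s = (k+1) s], so [s = 0]
    and the form of [X] vanishes at [z]. *)
Lemma isotropic_projections_total k (x : 'cV[C]_(d * d)) : (0 < k)%N ->
  (k.*2.+1 < d)%N ->
  (forall Z : 'M[C]_(d, k), isotropic V Z -> (vecm (Z *m Z ^t*)) ^t* *m x = 0) ->
  x = 0.
Proof.
have [X ->] := vecm_surj x => k0 kd X0.
suff -> : X = 0 by apply/matrixP => p j; rewrite !mxE.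
apply: unit_vector_polarization => z zz.
have [Z isoZ [l0 <-]] := isotropic_through V_skew kd zz.
pose s := \tr (Z ^t* *m X *m Z).
have qE l : ((col l Z) ^t* *m X *m col l Z) 0 0 = (Z ^t* *m X *m Z) l l.
  rewrite !mxE; apply: eq_bigr => i _; rewrite !mxE; congr (_ * _).
  by apply: eq_bigr => j _; rewrite !mxE.
have qs l : (Z ^t* *m X *m Z) l l = s.
  have := X0 _ (isotropic_col' l isoZ); move=> /(congr1 (fun M : 'M_1 => M 0 0)).
  rewrite vecm_dot adjmx_mul trmxCK mxtrace_mulC mxE => q0.
  have ZZE : Z *m Z ^t* = col l Z *m (col l Z) ^t* + col' l Z *m (col' l Z) ^t*.
    apply/matrixP => a b; rewrite !mxE big_ord1 (bigD1_ord l) //=; congr (_ + _).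
      by rewrite !mxE.
    by apply: eq_bigr => i _; rewrite !mxE.
  rewrite -qE sesqui_mxtrace /s -[Z ^t* *m X *m Z]mulmxA [RHS]mxtrace_mulC.
  by rewrite -mulmxA ZZE mulmxDr mxtraceD q0 addr0.
have : s = k.+1%:R * s.
  rewrite {1}/s /mxtrace (eq_bigr (fun=> s)) // sumr_const card_ord mulr_natl //.
rewrite -{1}[s]mul1r => /eqP; rewrite -subr_eq0 -mulrBl mulf_eq0 -natr1 opprD.
rewrite addrCA subrr addr0 oppr_eq0 pnatr_eq0 -leqn0 leqNgt k0 => /eqP s0.
by rewrite qE qs.
Qed.

(** The pairing with [vecm X] is the quadratic form of [X V] at [z], so polarization applies. *)
Lemma skew_products_total (x : 'cV[C]_(d * d)) :
  (forall z : 'cV[C]_d, (vecm (z *m (V *m z) ^t*)) ^t* *m x = 0) -> x = 0.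
Proof.
have [X ->] := vecm_surj x => X0.
suff XV0 : X *m V = 0.
  have -> : X = 0 by rewrite -[X](mulmxK (unitarymx_unit V_unitary)) XV0 mul0mx.
  by apply/matrixP => p j; rewrite !mxE.
apply: quadratic_polarization => z.
have := X0 z => /(congr1 (fun M : 'M_1 => M 0 0)); rewrite vecm_dot mxE => <-.
by rewrite !adjmx_mul !trmxCK sesqui_mxtrace [RHS]mxtrace_mulC !mulmxA.
Qed.

(** * The Breuer-Hall map for a fixed [k] with [2(k+1) <= d] *)

Section Fixed_k.
Variable k : nat.
Hypotheses (k_gt0 : (0 < k)%N) (k_lt : (k.*2.+1 < d)%N).

Lemma BHmap_scale_gt0 : 0 < k%:R * d%:R - k%:R - 1 :> C.
Proof.
rewrite -addrA -opprD subr_gt0 -natrM natr1 ltr_nat.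
have : (k.*2.+2 <= k * d)%N by apply: leq_trans k_lt _; rewrite leq_pmull.
by apply: leq_trans; rewrite !ltnS -addnn leq_addr.
Qed.

Lemma BHmap_not_k1_positive : ~ k_positive k.+1 (BHmap k V).
Proof.
move=> Lk; have [Z isoZ] := isotropic_exists d_gt0 V_skew k_lt.
have := k_positive_choi_ge0 Z (Z ^t*) d_gt0 Lk.
rewrite choi_BHmap_isotropic // pmulr_rge0; last first.
  by rewrite divr_gt0 ?invr_gt0 ?ltr0n ?BHmap_scale_gt0.
by rewrite pmulr_rge0 ?ltr0n // subr_ge0 ler_nat ltnn.
Qed.

Lemma BHmap_not_sum_of_positive (L' L'' : {linear 'M[C]_d -> 'M[C]_d}) :
  k_positive k.+1 L' -> k_positive k.+1 L'' ->
  ~ forall Z, BHmap k V Z = L' Z + (L'' Z)^T.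
Proof.
move=> L'k L''k LE; have choiE : choi (BHmap k V) = choi L' + choi (trmx \o L'').
  by rewrite -choiD; apply: eq_choi.
(* As [k >= 1], the maps are at least 2-positive, as [k_positive_product_kernel] requires. *)
have [k' kE] : exists k', k = k'.+1 by exists k.-1; rewrite prednK.
have L''0 (z : 'cV[C]_d) : choi L'' *m vecm (z *m (V *m z) ^t*) = 0.
  rewrite -[(V *m z) ^t*]trmxK; apply: (@k_positive_product_kernel _ k') => //.
    by rewrite -kE.
  have := choi_BHmap_symmetric V_unitary V_skew k z.
  (* Both summands are nonnegative at product vectors and add up to zero, so the one coming from
     [L''] vanishes. *)
  rewrite choiE mulmxDr mulmxDl mxE choi_trmx_product => /eqP.
  rewrite paddr_eq0; first by rewrite trmxK => /andP[_ /eqP].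
    by apply: k_positive_rank1_ge0 L'k.
  by apply: k_positive_rank1_ge0 L''k.
have {}L''0 : choi L'' = 0.
  apply/row_matrixP => p; rewrite row0 -[row p _]trmxCK.
  have -> : (row p (choi L'')) ^t* = 0.
    apply: skew_products_total => z; rewrite -adjmx_mul -row_mul L''0.
    by rewrite row0 trmx0 map_mx0.
  by rewrite trmx0 map_mx0.
apply: BHmap_not_k1_positive; apply: choi_ge0_k_positive => // M N.
have -> : choi (BHmap k V) = choi L'.
  by apply: eq_choi => Z; rewrite LE (choi_eq0 _ _ L''0) // trmx0 addr0.
exact: k_positive_choi_ge0.
Qed.

Lemma BHmap_indecomposable : ~ decomposable (BHmap k V).
Proof.
move=> [L1 [L2 [L1_cp L2_cocp LE]]].
(* The completely positive map attached to [L2] is its transpose, and transposing once more recovers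
   [L2]. *)
apply: (@BHmap_not_sum_of_positive L1 (trmx \o L2)) => // Z.
by rewrite LE /= trmxK.
Qed.

Lemma BHmap_optimal (L' : {linear 'M[C]_d -> 'M[C]_d}) : k_positive k L' ->
  (forall rho, detects (BHmap k V) rho -> detects L' rho) ->
  exists2 c : C, 0 < c & forall Z, L' Z = c *: BHmap k V Z.
Proof.
move=> L'k det.
have tr_gram (G M : 'M[C]_(d * d)) :
    \tr (G ^t* *m G *m M) = \sum_i (row i G *m M *m (row i G) ^t*) 0 0.
  rewrite -mulmxA mxtrace_mulC; apply: eq_bigr => i _.
  by rewrite -row_mul [LHS]mxE [RHS]mxE;
    apply: eq_bigr => j _; rewrite !mxE.
pose isoproj (psi : 'cV[C]_(d * d)) :=
  exists2 Z : 'M[C]_(d, k), isotropic V Z & psi = vecm (Z *m Z ^t*).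
have [|G1 G1u G1P] := @total_frame _ _ isoproj.
  move=> x x0; apply: (isotropic_projections_total k_gt0 k_lt) => Z isoZ.
  by apply: x0; exists Z.
pose skewprod (psi : 'cV[C]_(d * d)) :=
  exists z : 'cV[C]_d, psi = vecm (z *m (V *m z) ^t*).
have [|G2 G2u G2P] := @total_frame _ _ skewprod.
  by move=> x x0; apply: skew_products_total => z; apply: x0; exists z.
have [z zP] := fin_all_exists G2P.
pose S := G1 ^t* *m G1.
(* [R] uses the untransposed product vectors, on which the Breuer-Hall form vanishes; its partial
   transpose is the Gram matrix of the frame [G2]. *)
pose R := \sum_i vecm (z i *m (V *m z i)^T) *m (vecm (z i *m (V *m z i)^T)) ^t*.
have ptransR : ptrans R = G2 ^t* *m G2.
  rewrite /R linear_sum gram_rows; apply: eq_bigr => i _ /=.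
  by rewrite -ptrans_product ptransK -zP trmxCK.
have trS M : \tr (S *m M) = \sum_i (row i G1 *m M *m (row i G1) ^t*) 0 0.
  exact: tr_gram.
have rowG i (Y : 'M[C]_d) : (row i G1) ^t* = vecm Y -> row i G1 = (vecm Y) ^t*.
  by move=> <-; rewrite trmxCK.
have trR M : \tr (R *m M) =
    \sum_i ((vecm (z i *m (V *m z i)^T)) ^t* *m M *m vecm (z i *m (V *m z i)^T)) 0 0.
  rewrite /R mulmx_suml raddf_sum; apply: eq_bigr => i _ /=.
  by rewrite sesqui_mxtrace mxtrace_mulC.
have [c c0 cE] : exists2 c : C, 0 < c & choi L' = c *: choi (BHmap k V).
  have [Z isoZ] := isotropic_exists d_gt0 V_skew k_lt.
  (* The base point comes from [k+1] isotropic columns, where the form is negative. *)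
  apply: (@functional_proportional _ _ _ _ (vecm (Z *m Z ^t*))).
  - exact: choi_BHmap_hermitian.
  - rewrite choi_BHmap_isotropic // pmulr_rlt0; last first.
      by rewrite divr_gt0 ?invr_gt0 ?ltr0n ?BHmap_scale_gt0.
    by rewrite pmulr_rlt0 ?ltr0n // subr_lt0 ltr_nat.
  - move=> H hH; apply: (@detection_transfer _ _ _ _ S R) => //.
    + by move=> H'; apply: frame_psd_shift.
    + by move=> H'; rewrite ptransR; apply: frame_psd_shift.
    + exact: psdmx_gram.
    + rewrite /R; apply: (big_ind (@psdmx C _)).
      * by move=> x; rewrite mulmx0 mul0mx mxE.
      * exact: psdmxD.
      * by move=> i _; rewrite -{1}[vecm _]trmxCK; apply: psdmx_gram.
    + rewrite trS big1 // => i _; have [Y isoY YE] := G1P i.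
      by rewrite YE (rowG _ _ YE) choi_BHmap_isotropic // subrr !mulr0.
    + by rewrite trR big1 // => i _; rewrite choi_BHmap_symmetric.
    + rewrite trS; apply: sumr_ge0 => i _; have [Y isoY YE] := G1P i.
      by rewrite YE (rowG _ _ YE); apply: k_positive_choi_ge0.
    + by rewrite trR; apply: sumr_ge0 => i _; apply: k_positive_rank1_ge0 L'k.
    + by move=> rho ppt_rho rhoW; have [] := det rho (conj ppt_rho rhoW).
exists c => // Z; have := @choi_inj _ d L' (c \*: BHmap k V) d_gt0; apply.
apply: tblock_inj => i j; rewrite cE.
have -> : tblock (c *: choi (BHmap k V)) i j = c *: tblock (choi (BHmap k V)) i j.
  by apply/matrixP => a b; rewrite !mxE.
by rewrite !tblock_choi scalerA mulrC -scalerA.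
Qed.

End Fixed_k.
End Optimality.

(** * The theorem over the complex numbers *)

Local Open Scope complex_scope.

Theorem theorem1p2 (R : realType) (d : nat) (hd : (4 <= d)%N)
    (hd_even : ~~ odd d) (V : 'M[R[i]]_d) (hV : V \is unitarymx)
    (hV_skew : V^T = - V) (k : nat) (hk : (1 <= k <= d./2 - 1)%N) :
  optimal_k_positive_indecomposable k (BHmap k V) /\
  ~ exists L' L'' : {linear 'M[R[i]]_d -> 'M[R[i]]_d},
      [/\ k_positive k.+1 L', k_positive k.+1 L'' &
          forall Z, BHmap k V Z = L' Z + (L'' Z)^T].
Proof.
have d_gt0 : (0 < d)%N by apply: leq_trans hd.
have /andP[k_gt0 k_le] := hk.
have k_lt : (k.*2.+1 < d)%N.
  (* Evenness gives [d = 2 (d/2)], so [k <= d/2 - 1] becomes [2(k+1) <= d]. *)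
  rewrite -doubleS -[d]even_halfK // leq_double.
  by rewrite -(subnK (_ : 1 <= d./2)%N) ?addn1 ?ltnS // half_gt0 (leq_trans _ hd).
split; last first.
  move=> [L' [L'' [L'k L''k LE]]].
  exact: (BHmap_not_sum_of_positive d_gt0 hV hV_skew k_gt0 k_lt L'k L''k LE).
split.
- by apply: BHmap_k_positive => //; apply/ltW/BHmap_scale_gt0.
- exact: BHmap_not_k1_positive.
- exact: BHmap_indecomposable.
- by move=> L' L'k _; apply: BHmap_optimal.
Qed.
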